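(* Let $n \ge 3$. The mean statistics on $\mathfrak{S}_n$ associated with the descent number, major index and inversion number decompose into irreducible characters as \[ \begin{split} \overline{\mathrm{des}} &= \frac{n-1}{2}\chi^{(n)} - \frac{1}{n}\chi^{(n-1,1)} - \frac{1}{n}\chi^{(n-2,1,1)},\\ \overline{\mathrm{maj}} &= \frac{n}{2}\overline{\mathrm{des}} = \frac{n(n-1)}{4}\chi^{(n)} - \frac{1}{2}\chi^{(n-1,1)} - \frac{1}{2}\chi^{(n-2,1,1)},\\ \overline{\mathrm{inv}} &= \frac{n(n-1)}{4}\chi^{(n)} - \frac{n+1}{6}\chi^{(n-1,1)} - \frac{1}{6}\chi^{(n-2,1,1)}. \end{split} \]
   Context: For $\pi\in\mathfrak{S}_n$, a descent is an index $i\in[n-1]$ with $\pi(i)>\pi(i+1)$; $\mathrm{des}(\pi)$ is the number of descents and $\mathrm{maj}(\pi)$ is the sum of all descents. An inversion is a pair $1\le i<j\le n$ with $\pi(i)>\pi(j)$, and $\mathrm{inv}(\pi)$ is the number of inversions. For a function $\mathfrak{s}:\mathfrak{S}_n\to\mathbb{R}$, the mean statistic $\overline{\mathfrak{s}}$ is the class function whose value on a permutation of cycle type $\lambda$ is $\frac{1}{|C_\lambda|}\sum_{\pi\in C_\lambda}\mathfrak{s}(\pi)$, where $C_\lambda$ is the conjugacy class of permutations of cycle type $\lambda$. $\chi^\lambda$ denotes the irreducible character of $\mathfrak{S}_n$ indexed by the partition $\lambda\vdash n$ in the standard way; $\chi^{(n)}$ is the trivial character. *)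

(* Defs.v *)
From HB Require Import structures.
From mathcomp Require Import all_boot all_order all_algebra all_fingroup.
From mathcomp Require Import all_solvable all_field all_character.

Set Implicit Arguments.
Unset Strict Implicit.
Unset Printing Implicit Defensive.

Import GroupScope GRing.Theory.
Local Open Scope ring_scope.

(* Positions and values lie in 'I_n = {0, ..., n-1}. Both are shifted by one
   from [n], so the descent index of position i (0-based) is i.+1. *)
Definition descents n (p : 'S_n) : {set 'I_n} :=
  [set i : 'I_n | [exists j : 'I_n, (j == i.+1 :> nat) && (p j < p i)%N]].

Definition num_descents n (p : 'S_n) : nat := #|descents p|.

Definition major_index n (p : 'S_n) : nat := (\sum_(i in descents p) i.+1)%N.

Definition num_inversions n (p : 'S_n) : nat :=
  #|[set ij : 'I_n * 'I_n | (ij.1 < ij.2)%N && (p ij.2 < p ij.1)%N]|.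

Definition cycle_type n (p : 'S_n) : seq nat :=
  sort geq [seq #|B| | B : {set 'I_n} in porbits p].

Definition perms_of_type n (lambda : seq nat) : {set 'S_n} :=
  [set p : 'S_n | cycle_type p == lambda].

Lemma cycle_typeJ n (p s : 'S_n) : cycle_type (p ^ s)%g = cycle_type p.
Proof.
have porbJ x : porbit (p ^ s)%g (s x) = s @: porbit p x.
  apply/setP=> y; apply/porbitP/imsetP => [[i ->] | [z /porbitP[i ->] ->]].
    exists ((p ^+ i)%g x); first exact: mem_porbit.
    by rewrite -conjXg permJ.
  by exists i; rewrite -conjXg permJ.
have porbsJ : porbits (p ^ s)%g = (fun B : {set 'I_n} => s @: B) @: porbits p.
  apply/setP=> B; apply/imsetP/imsetP => [[x _ ->] | [C /imsetP[x _ ->] ->]].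
    exists (porbit p (s^-1%g x)); first exact: imset_f.
    by rewrite -porbJ permKV.
  by exists (s x); rewrite ?porbJ.
have injs : injective (fun B : {set 'I_n} => s @: B).
  exact/imset_inj/perm_inj.
apply/perm_sortP; [exact: (fun m k => leq_total k m)| | |].
- by move=> m k l Hmk Hkl; apply: leq_trans Hkl Hmk.
- by move=> m k; rewrite andbC -eqn_leq => /eqP.
rewrite porbsJ.
have /(perm_map (fun B : {set 'I_n} => #|B|)) :
    perm_eq (enum ((fun B : {set 'I_n} => s @: B) @: porbits p))
            [seq s @: (B : {set 'I_n}) | B <- enum (porbits p)].
  apply: uniq_perm; rewrite ?enum_uniq ?map_inj_uniq ?enum_uniq // => B.
  rewrite mem_enum; apply/imsetP/mapP => -[C HC ->]; exists C => //;
    by rewrite mem_enum in HC *.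
move=> H; apply: (perm_trans H); rewrite -map_comp.
by rewrite (eq_map (g := fun B : {set 'I_n} => #|B|)) // => B /=;
   rewrite card_imset //; apply: perm_inj.
Qed.

Fact mean_stat_subproof n (s : 'S_n -> algC) :
  is_class_fun <<[set: 'S_n]>>
    [ffun p : 'S_n => let C := perms_of_type n (cycle_type p) in
                      (#|C|%:R)^-1 * \sum_(q in C) s q].
Proof.
rewrite genGid; apply: intro_class_fun => [p q _ _ | p]; last by rewrite inE.
by rewrite cycle_typeJ.
Qed.

Definition mean_stat n (s : 'S_n -> algC) : 'CF([set: 'S_n]) :=
  Cfun 0 (mean_stat_subproof s).

(* The tableau of shape lambda (a partition of n) filled with 0, ..., n-1 in
   reading order: entry i lies in row reshape_index lambda i and in column
   reshape_offset lambda i. *)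
Definition row_stab n (lambda : seq nat) : {set 'S_n} :=
  [set p : 'S_n |
    [forall i, reshape_index lambda (p i) == reshape_index lambda i]].

Definition col_stab n (lambda : seq nat) : {set 'S_n} :=
  [set q : 'S_n |
    [forall i, reshape_offset lambda (q i) == reshape_offset lambda i]].

(* sum of sgn(q) (p q) over p in the row stabilizer and q in the column
   stabilizer, as an element of the group algebra, i.e., of the space of the
   regular representation, with basis indexed by the permutations. *)
Definition young_symmetrizer n (lambda : seq nat) : 'rV[algC]_#|[set: 'S_n]| :=
  \sum_(p in row_stab n lambda) \sum_(q in col_stab n lambda)
    (-1) ^+ q *: delta_mx 0 (gring_index [set: 'S_n] (p * q)%g).

(* MathComp groups act on row vectors from the right and its permutations
   compose from left to right, so the Specht module is the right ideal
   generated by the Young symmetrizer. *)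
Definition specht_repr n (lambda : seq nat) :=
  submod_repr (cyclic_mx_module (regular_repr algC [set: 'S_n])
                                (young_symmetrizer n lambda)).

(* chi^lambda. Defined for every sequence, but irreducible and meaningful only
   when lambda is a partition of n: nonincreasing, positive parts, sum n. *)
Definition specht_char n (lambda : seq nat) : 'CF([set: 'S_n]) :=
  cfRepr (specht_repr n lambda).

(* Main.v *)
(* Write f and f2 for the numbers of fixed points of g and of g^2.  Modulo the
   row stabilizer, a permutation is determined by the images of the points below
   the first row, so the Young symmetrizers of shapes (n-1,1) and (n-2,1,1)
   become e_i - e_j and the alternating sum of three pairs (i,j), (j,k), (k,i).
   The modules they generate have explicit projections, whose twisted traces are
   f - 1 and (f^2 - f2)/2 + 1 - f.

   Since f and f2 depend only on the cycle type, a mean statistic can be computed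
   by averaging over all conjugates g of a fixed permutation.  For i < j, the
   number of conjugates with (g i, g j) = (k, l) depends only on the pattern of
   equalities among i, j, k, l; summing the sign of k - l against it shows that
   the mean of [g j < g i] is an affine function of j - i. *)

Require Import Defs.
From mathcomp Require Import all_boot all_order all_algebra all_fingroup.
From mathcomp Require Import all_solvable all_field all_character.
From mathcomp Require Import ring zify.

Import GRing.Theory Num.Theory.
Local Open Scope ring_scope.

Set Implicit Arguments.
Unset Strict Implicit.
Unset Printing Implicit Defensive.

(** * Traces on submodules as twisted traces of projections *)

(** The hypotheses make [P] a projection onto [U], which factors through coordinates in a basis of
    [U]; cyclicity of the trace then moves the computation to the ambient space. *)
Lemma mxtrace_submod_repr (F : fieldType) (gT : finGroupType) (G : {group gT})
    (N : nat) (rG : mx_representation F G N) (U : 'M[F]_N)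
    (Umod : mxmodule rG U) (P : 'M[F]_N) (x : gT) :
  x \in G -> (P <= U)%MS -> (U *m P = U)%MS ->
  \tr (submod_repr Umod x) = \tr (P *m rG x).
Proof.
move=> Gx sPU UP; rewrite /= /submod_mx.
set B := val_submod 1%:M.
have BP : B *m P = B.
  have /submxP[D ->] : (B <= U)%MS by apply: val_submodP.
  by rewrite -mulmxA UP.
rewrite -[in LHS]BP -mulmxA in_submodE -mulmxA mxtrace_mulC -in_submodE.
by rewrite -val_submodE in_submodK // mxmodule_trans.
Qed.

(* The hypotheses say that v |-> sum_i c_i v_(k_i) T_i is a projection onto the
   cyclic module. *)
Lemma mxtrace_cyclic_repr (F : fieldType) (gT : finGroupType) (G : {group gT}) (N : nat)
    (rG : mx_representation F G N) (u : 'rV[F]_N) (I : finType)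
    (T : I -> 'rV[F]_N) (c : I -> F) (k : I -> 'I_N) (x : gT) :
  (forall i, T i <= cyclic_mx rG u)%MS ->
  (forall h, h \in G ->
     u *m rG h = \sum_i (c i * (u *m rG h) 0 (k i)) *: T i) ->
  x \in G ->
  \tr (submod_repr (cyclic_mx_module rG u) x)
    = \sum_i c i * (T i *m rG x) 0 (k i).
Proof.
move=> TU fixu Gx;
pose P : 'M[F]_N := \sum_i c i *: (delta_mx (k i) 0 *m T i).
have rowP (v : 'rV_N) : v *m P = \sum_i (c i * v 0 (k i)) *: T i.
  rewrite mulmx_sumr; apply: eq_bigr => i _.
  rewrite -scalemxAr mulmxA -scalerA; congr (_ *: _).
  by rewrite -colE [col _ _]mx11_scalar mul_scalar_mx mxE.
rewrite (@mxtrace_submod_repr _ _ _ _ _ _ _ P) //.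
- rewrite /P mulmx_suml raddf_sum; apply: eq_bigr => i _ /=.
  rewrite -scalemxAl mxtraceZ -mulmxA mxtrace_mulC -colE.
  by rewrite [col _ _]mx11_scalar mxtrace_scalar mulr1n mxE.
- by apply: summx_sub => i _; rewrite scalemx_sub // mulmx_sub.
- apply/row_matrixP => i; rewrite row_mul.
  (* It suffices to test the projection on the translates of [u], which span the module. *)
  have /cyclic_mxP[A /envelop_mxP[a ->] ->] := row_sub i (cyclic_mx rG u).
  rewrite (mulmx_sumr u) mulmx_suml; apply: eq_bigr => h Gh.
  by rewrite -scalemxAr -scalemxAl rowP -fixu.
Qed.

(** * Coset sums in the group algebra *)

Section RegularModule.

Variable n : nat.
Local Notation G := [set: 'S_n]%G.
Local Notation aG := (regular_repr algC G).
Local Notation D g := (delta_mx 0 (gring_index G g) : 'rV[algC]_#|G|).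

Definition perm_sum (A : pred 'S_n) : 'rV[algC]_#|G| := \sum_(g | A g) D g.

Lemma regular_delta (g h : 'S_n) : D g *m aG h = D (g * h)%g.
Proof. by rewrite -rowE rowK gring_indexK ?inE. Qed.

Lemma perm_sum_coef (A : pred 'S_n) (g : 'S_n) :
  perm_sum A 0 (gring_index G g) = (A g)%:R.
Proof.
rewrite summxE (bigID (pred1 g)) /= [X in _ + X]big1 ?addr0 => [|h /andP[_ hg]].
  rewrite big_mkcondl /= (big_pred1 g) // mxE !eqxx; by case: (A g).
rewrite mxE eqxx /= (inj_in_eq (can_in_inj (@gring_indexK _ G))) ?inE //.
by rewrite eq_sym (negPf hg).
Qed.

Lemma perm_sumM (A : pred 'S_n) (h : 'S_n) :
  perm_sum A *m aG h = perm_sum (fun g => A (g * h^-1)%g).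
Proof.
rewrite mulmx_suml [RHS](reindex_inj (mulIg h)) /=.
by apply: eq_big => g; rewrite ?mulgK // regular_delta.
Qed.

(** Terms with the same [q] fill out a right coset of the row stabilizer. *)
Lemma young_symmetrizer_perm_sum (lambda : seq nat) :
  young_symmetrizer n lambda = \sum_(q in col_stab n lambda)
    (-1) ^+ q *: perm_sum (fun g => g \in row_stab n lambda :* q)%g.
Proof.
rewrite /young_symmetrizer exchange_big; apply: eq_bigr => q _.
rewrite /perm_sum scaler_sumr (reindex_inj (mulIg q^-1%g)) /=.
apply: eq_big => g; first by rewrite mem_rcoset.
by rewrite mulgKV.
Qed.


(** The common frame for the three shapes: the projection has its image spanned by the [T i], and
    [k i] is a permutation at which the [i]-th coordinate is read off. *)
Lemma cfRepr_specht (lambda : seq nat) (I : finType)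
    (T : I -> 'rV[algC]_#|G|) (c : I -> algC) (k : I -> 'S_n) (x : 'S_n) :
  (forall i, T i <= cyclic_mx aG (young_symmetrizer n lambda))%MS ->
  (forall h : 'S_n, young_symmetrizer n lambda *m aG h = \sum_i
     (c i * (young_symmetrizer n lambda *m aG h) 0 (gring_index G (k i))) *: T i) ->
  specht_char n lambda x = \sum_i c i * (T i *m aG x) 0 (gring_index G (k i)).
Proof.
move=> TU fixu; rewrite cfunE inE mulr1n.
by apply: mxtrace_cyclic_repr; rewrite ?inE.
Qed.

(** By induction: a permutation fitting the tails is corrected by a transposition that leaves the
    images of the tail alone. *)
Lemma perm_extends (u v : seq 'I_n) :
  uniq u -> uniq v -> size u = size v -> exists s : 'S_n, map s u = v.
Proof.
elim: u v => [|x u IH] [|y v] //=; first by exists 1%g.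
move=> /andP[xu uu] /andP[yv uv] [] /(IH v uu uv)[s sv].
exists (s * tperm (s x) y)%g; rewrite permM tpermL; congr (_ :: _).
rewrite -sv; apply/eq_in_map => z zu; rewrite permM tpermD //.
  by rewrite (inj_eq perm_inj); apply: contraNneq xu => ->.
by apply: contraNneq yv => ->; rewrite -sv map_f.
Qed.

End RegularModule.


(** * Tableaux of hook shape *)

Lemma reshape_index_cons (k i : nat) (s : seq nat) :
  reshape_index (k :: s) i = if (i < k)%N then 0%N else (reshape_index s (i - k)).+1.
Proof.
by rewrite /reshape_index /= subn_eq0; case: ltnP => // ki; rewrite subSn.
Qed.

Lemma reshape_offset_cons (k i : nat) (s : seq nat) :
  reshape_offset (k :: s) i = if (i < k)%N then i else reshape_offset s (i - k).
Proof.
rewrite /reshape_offset reshape_index_cons; case: ltnP => _ /=; first by rewrite subn0.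
by rewrite subnDA.
Qed.

Lemma perm_on2P (A : finType) (a b : A) (q : {perm A}) :
  perm_on [set a; b] q -> q = 1%g \/ q = tperm a b.
Proof.
move=> qS; have out x : x != a -> x != b -> q x = x.
  by move=> xa xb; apply: (out_perm qS); rewrite !inE negb_or xa.
have [ab|ab] := eqVneq a b.
  left; apply/permP => x; rewrite perm1; have [->|xa] := eqVneq x a.
    by have := perm_closed a qS; rewrite !inE eqxx -ab orbb => /eqP.
  by rewrite out -?ab.
have qab : q a != q b by rewrite (inj_eq perm_inj).
have := perm_closed b qS; have := perm_closed a qS; rewrite !inE !eqxx orbT /=.
case/orP => /eqP qa; case/orP => /eqP qb; try by rewrite qa qb eqxx in qab.
  left; apply/permP => x; rewrite perm1.
  by have [->//|xa] := eqVneq x a; have [->//|xb] := eqVneq x b; rewrite out.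
by right; apply/permP => x; case: tpermP => [->|->|/eqP xa /eqP xb] //; exact: out.
Qed.

(** Following [q] by the transposition of [c] and [q c] fixes [c], which leaves a permutation of two
    points. *)
Lemma perm_on3P (A : finType) (a b c : A) (q : {perm A}) :
  a != c -> b != c -> perm_on [set a; b; c] q ->
  q \in [:: 1; tperm a b; tperm a c; tperm b c;
            tperm a b * tperm a c; tperm a b * tperm b c]%g.
Proof.
move=> ac bc qS.
have : perm_on [set a; b] (q * tperm c (q c))%g.
  apply/subsetP => x; rewrite !inE permM; apply: contraR.
  rewrite negb_or => /andP[xa xb].
  have [->|xc] := eqVneq x c; first by rewrite tpermR.
  have qx : q x = x by rewrite (out_perm qS) // !inE !negb_or xa xb xc.
  by rewrite qx tpermD // 1?eq_sym // -{1}qx (inj_eq perm_inj).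
have qc : [\/ q c = a, q c = b | q c = c].
  have := perm_closed c qS; rewrite !inE eqxx orbT.
  by case/orP => [/orP[]|] /eqP ->; [constructor 1 | constructor 2 | constructor 3].
have qE : q = (q * tperm c (q c) * tperm c (q c))%g by rewrite -mulgA tperm2 mulg1.
move=> /perm_on2P[] qt; rewrite qE qt {qt qE}; rewrite ?mul1g !inE; case: qc => ->;
  by rewrite ?tperm1 ?mulg1 1?(tpermC c) eqxx ?orbT.
Qed.

(** For the hook tableau: antisymmetrising over the three cells of the first column leaves a cyclic
    sum of oriented pairs. *)
Lemma big_perm_on3 (A : finType) (V : lmodType algC) (F : A -> A -> V) (a b c : A) :
  a != b -> a != c -> b != c ->
  \sum_(q in [:: 1; tperm a b; tperm a c; tperm b c;
                tperm a b * tperm a c; tperm a b * tperm b c]%g)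
     (-1) ^+ (q : {perm A}) *: F (q b) (q c)
    = (F b c - F c b) + (F c a - F a c) + (F a b - F b a).
Proof.
move=> ab ac bc; have [ba ca cb] : [/\ b != a, c != a & c != b].
  by rewrite eq_sym ab eq_sym ac eq_sym bc.
have D : (tperm a b c = c) * (tperm a c b = b) * (tperm b c a = a).
  by rewrite !tpermD.
rewrite -big_uniq; last first.
  (* The images of [b] and [c] tell the six permutations apart. *)
  apply: (map_uniq (f := fun s : {perm A} => (s b, s c))).
  rewrite /= !permM !perm1 !(tpermL, tpermR, D).
  by rewrite !inE !xpair_eqE !eqxx (negPf ab) (negPf ac) (negPf bc)
    (negPf ba) (negPf ca) (negPf cb).
rewrite !big_cons big_nil !odd_permM odd_perm1 !odd_tperm ab ac bc /=.
rewrite !permM !perm1 !(tpermL, tpermR, D).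
rewrite !scaleN1r !scale1r addr0.
by rewrite !addrA [LHS](ACl (1*4*5*2*6*3)).
Qed.

Definition fixed_points (n : nat) (g : 'S_n) : algC := \sum_i (g i == i)%:R.

(** * The characters of shapes (n), (n-1,1) and (n-2,1,1) *)

Section SpechtCharacters.

Variable m : nat.
Local Notation n := m.+3.
Local Notation G := [set: 'S_n]%G.
Local Notation aG := (regular_repr algC G).

(** [p0] is the top left cell; below it lies [p2] in shape (n-1,1), and [p1] then [p2] in shape
    (n-2,1,1). *)
Let p0 : 'I_n := ord0.
Let p1 : 'I_n := inord m.+1.
Let p2 : 'I_n := ord_max.

Let val_p1 : p1 = m.+1 :> nat. Proof. by rewrite inordK //; lia. Qed.
Let p01 : p0 != p1. Proof. by rewrite -val_eqE /= val_p1. Qed.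
Let p02 : p0 != p2. Proof. by []. Qed.
Let p12 : p1 != p2. Proof. by rewrite -val_eqE /= val_p1; lia. Qed.

Lemma row_stab_row : row_stab n [:: n] = setT.
Proof.
apply/setP => p; rewrite !inE; apply/forallP => i.
by rewrite !reshape_index_cons !ltn_ord.
Qed.

Lemma col_stab_row : col_stab n [:: n] = [set 1%g].
Proof.
apply/setP => p; rewrite !inE; apply/forallP/eqP => [H | -> i].
  apply/permP => i; apply: val_inj; have /eqP := H i.
  by rewrite !reshape_offset_cons !ltn_ord perm1.
by rewrite perm1.
Qed.

Lemma row_stab_std (p : 'S_n) : (p \in row_stab n [:: m.+2; 1%N]) = (p p2 == p2).
Proof.
have ind (i : 'I_n) : reshape_index [:: m.+2; 1%N] i = (i == p2).
  rewrite !reshape_index_cons -val_eqE /=; have hi := ltn_ord i.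
  case: ltnP => h1; first by rewrite ltn_eqF.
  have -> : i = m.+2 :> nat by lia.
  by rewrite subnn eqxx.
rewrite inE; apply/forallP/eqP => [/(_ p2) | pp i]; rewrite !ind.
  by rewrite eqxx; case: (p p2 =P p2).
by rewrite -{1}pp (inj_eq perm_inj).
Qed.

Lemma row_stab_hook (p : 'S_n) :
  (p \in row_stab n [:: m.+1; 1%N; 1%N]) = (p p1 == p1) && (p p2 == p2).
Proof.
have ind (i : 'I_n) : reshape_index [:: m.+1; 1%N; 1%N] i = ((i == p1) + (i == p2).*2)%N.
  rewrite !reshape_index_cons -!val_eqE /= val_p1; have hi := ltn_ord i.
  case: ltnP => h1; first by rewrite !ltn_eqF //; lia.
  have [-> | ->] : i = m.+1 :> nat \/ i = m.+2 :> nat by lia.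
    by rewrite subnn eqxx ltn_eqF.
  by rewrite subSn // subnn subnn eqxx gtn_eqF.
rewrite inE; apply/forallP/andP => [H | [/eqP pp1 /eqP pp2] i].
  move: (H p1) (H p2); rewrite !ind !eqxx [p2 == p1]eq_sym (negPf p12).
  by case: (p p1 == p1); case: (p p1 == p2); case: (p p2 == p1); case: (p p2 == p2).
by rewrite !ind -{1}pp1 -{1}pp2 !(inj_eq perm_inj).
Qed.

(** Every column but the first is a single cell, so only the cells of the first column can move. The
    hook shape below is alike. *)
Lemma col_stab_std : col_stab n [:: m.+2; 1%N] =i [:: 1; tperm p0 p2]%g.
Proof.
have off (i : 'I_n) : reshape_offset [:: m.+2; 1%N] i = if i == p2 then 0%N else i.
  rewrite !reshape_offset_cons -val_eqE /=; have hi := ltn_ord i.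
  case: ltnP => h1; first by rewrite ifF //; lia.
  by rewrite (_ : i - m.+2 < 1)%N ?ifT; lia.
move=> q; rewrite !inE; apply/forallP/idP => [H | Hq i].
  suff /perm_on2P : perm_on [set p0; p2] q by case=> ->; rewrite eqxx ?orbT.
  apply/subsetP => i; rewrite !inE; apply: contraR; rewrite negb_or => /andP[i0 i2].
  have := H i; rewrite !off (negPf i2); case: ifP => // _.
  by rewrite eq_sym -[_ == _]/(i == p0) (negPf i0).
case/orP: Hq => /eqP ->; first by rewrite perm1 eqxx.
by case: tpermP => [->|->|_ _]; rewrite ?off ?eqxx.
Qed.

Lemma col_stab_hook : col_stab n [:: m.+1; 1%N; 1%N] =i
  [:: 1; tperm p0 p1; tperm p0 p2; tperm p1 p2;
      tperm p0 p1 * tperm p0 p2; tperm p0 p1 * tperm p1 p2]%g.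
Proof.
have off (i : 'I_n) : reshape_offset [:: m.+1; 1%N; 1%N] i =
    if (i == p1) || (i == p2) then 0%N else i.
  rewrite !reshape_offset_cons -!val_eqE /= val_p1; have hi := ltn_ord i.
  case: ltnP => h1; first by rewrite ifF //; lia.
  case: ltnP => h3; first by rewrite ifT; lia.
  by rewrite (_ : i - m.+1 - 1 < 1)%N ?ifT; lia.
move=> q; rewrite !inE [LHS]inE; apply/forallP/idP => [H | Hq i].
  suff /perm_on3P : perm_on [set p0; p1; p2] q by rewrite !inE; apply.
  apply/subsetP => i; rewrite !inE; apply: contraR; rewrite !negb_or.
  case/andP=> /andP[i0 i1] i2.
  have := H i; rewrite !off (negPf i1) (negPf i2); case: ifP => // _.
  by rewrite eq_sym -[_ == _]/(i == p0) (negPf i0).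
have t01 : reshape_offset [:: m.+1; 1%N; 1%N] (tperm p0 p1 i)
    = reshape_offset [:: m.+1; 1%N; 1%N] i.
  by case: tpermP => [->|->|//]; rewrite !off !eqxx ?orbT; case: ifP.
have t2 j k : j \in [:: p0; p1] ->
  reshape_offset [:: m.+1; 1%N; 1%N] (tperm j p2 k)
    = reshape_offset [:: m.+1; 1%N; 1%N] k.
  rewrite !inE => jP; case: tpermP => [->|->|//]; rewrite !off;
  by case/orP: jP => /eqP ->; rewrite !eqxx ?orbT; do ?case: ifP.
by move: Hq; do 5?[case/orP => [/eqP->|]]; last move/eqP ->;
   rewrite ?permM ?perm1 ?t2 ?t01 ?inE ?eqxx ?orbT.
Qed.


(** The group acts on the indices, so the blocks behave like points and like ordered pairs of
    distinct points; [hook_block i i] is zero. *)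
Local Notation std_block i := (perm_sum (fun g : 'S_n => g p2 == i)).
Local Notation hook_block i j :=
  (perm_sum (fun g : 'S_n => (g p1 == i) && (g p2 == j))).

Lemma std_blockM (i : 'I_n) (h : 'S_n) :
  std_block i *m aG h = std_block (h i).
Proof.
rewrite perm_sumM; apply: eq_bigl => g.
by rewrite permM -(inj_eq (@perm_inj _ h)) permKV.
Qed.

Lemma hook_blockM (i j : 'I_n) (h : 'S_n) :
  hook_block i j *m aG h = hook_block (h i) (h j).
Proof.
rewrite perm_sumM; apply: eq_bigl => g.
by rewrite !permM; congr (_ && _); rewrite -(inj_eq (@perm_inj _ h)) permKV.
Qed.

Lemma specht_char_row (g : 'S_n) : specht_char n [:: n] g = 1.
Proof.
have yE : young_symmetrizer n [:: n] = perm_sum predT.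
  rewrite young_symmetrizer_perm_sum col_stab_row big_set1 odd_perm1 scale1r.
  by apply: eq_bigl => q; rewrite row_stab_row rcoset1 inE.
have yM h : young_symmetrizer n [:: n] *m aG h = perm_sum predT.
  by rewrite yE perm_sumM.
(* The module is the line through the sum of all permutations; the coordinate is read off at the
   identity. *)
rewrite (@cfRepr_specht _ _ unit (fun=> perm_sum predT) (fun=> 1) (fun=> 1%g)).
- by rewrite sumr_const card_unit perm_sumM perm_sum_coef mulr1.
- by move=> _; rewrite yE; apply: cyclic_mx_id.
- by move=> h; rewrite yM sumr_const card_unit perm_sum_coef mulr1 scale1r.
Qed.

Lemma young_symmetrizer_std (h : 'S_n) :
  young_symmetrizer n [:: m.+2; 1%N] *m aG h = std_block (h p2) - std_block (h p0).
Proof.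
have bl (q : 'S_n) :
    perm_sum (fun g => g \in row_stab n [:: m.+2; 1%N] :* q)%g *m aG h
      = std_block (h (q p2)).
  rewrite -std_blockM; congr (_ *m _); apply: eq_bigl => g.
  by rewrite mem_rcoset row_stab_std permM -(inj_eq (@perm_inj _ q)) permKV.
rewrite young_symmetrizer_perm_sum mulmx_suml.
under eq_bigr do rewrite -scalemxAl bl.
rewrite (eq_bigl _ _ col_stab_std) -big_uniq /=; last first.
  rewrite inE andbT; apply/eqP => /(congr1 (fun s : 'S_n => s p0)).
  by rewrite perm1 tpermL => /eqP; rewrite (negPf p02).
rewrite !big_cons big_nil odd_perm1 odd_tperm p02 perm1 tpermR /=.
by rewrite scale1r scaleN1r addr0.
Qed.

(** The module is spanned by differences of blocks, and the projection subtracts from each block the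
    average of all blocks. In the twisted trace the blocks contribute the fixed points and the
    average contributes -1. *)
Lemma specht_char_std (g : 'S_n) :
  specht_char n [:: m.+2; 1%N] g = fixed_points g - 1.
Proof.
(* As an average of differences, [T i] visibly lies in the module. *)
pose T i := n%:R^-1 *: \sum_j (std_block i - std_block j).
have n0 : (n%:R : algC) != 0 by rewrite pnatr_eq0.
have TE i : T i = std_block i - n%:R^-1 *: \sum_j std_block j.
  rewrite /T sumrB sumr_const card_ord scalerBr -[std_block i *+ n]scaler_nat scalerA.
  by rewrite mulVf ?scale1r.
(* [k i] sends [p2] to [i], so the coefficient there detects [std_block i]. *)
pose k i := tperm p2 i.
have kE i j : std_block i 0 (gring_index G (k j)) = (j == i)%:R.
  by rewrite perm_sum_coef tpermL.
have LE i : \sum_j (1 * std_block i 0 (gring_index G (k j))) *: T j = T i.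
  rewrite (bigD1 i) //= kE eqxx mulr1 scale1r big1 ?addr0 // => j /negPf ji.
  by rewrite kE ji mulr0 scale0r.
rewrite (@cfRepr_specht _ _ _ T (fun=> 1) k).
- under eq_bigr => i _.
    rewrite mul1r TE mulmxBl std_blockM -scalemxAl mulmx_suml.
    rewrite (_ : \sum_j (std_block j *m aG g) = \sum_j std_block j); last first.
      by rewrite [RHS](reindex_inj (@perm_inj _ g));
        apply: eq_bigr => j _; rewrite std_blockM.
    rewrite !mxE kE summxE; under eq_bigr do rewrite kE.
    rewrite (bigD1 i) //= eqxx big1 ?addr0 => [|j /negPf]; last by rewrite eq_sym => ->.
    rewrite eq_sym mulr1.
  over.
  by rewrite sumrB sumr_const card_ord -[_ *+ n]mulr_natr mulVf.
- move=> i; rewrite scalemx_sub // summx_sub // => j _.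
  have [->|ij] := eqVneq i j; first by rewrite subrr sub0mx.
  have [||//|h [<- <-]] := @perm_extends n [:: p2; p0] [:: i; j].
  + by rewrite cons_uniq mem_seq1 eq_sym p02.
  + by rewrite cons_uniq mem_seq1 ij.
  rewrite -young_symmetrizer_std.
  by rewrite (mxmodule_trans (cyclic_mx_module _ _)) ?inE ?cyclic_mx_id.
- move=> h; rewrite young_symmetrizer_std.
  under eq_bigr do rewrite !mxE mulrDr mulrN scalerBl.
  by rewrite sumrB !LE !TE opprB addrA subrK.
Qed.


(** On the simplex with n vertices, [wedge i j] is an oriented edge and [hook_vec i j k] the
    boundary of an oriented triangle; the module is spanned by such boundaries. *)
Let wedge i j := hook_block i j - hook_block j i.
Let hook_vec i j k := wedge i j + wedge j k + wedge k i.

Let hook_vecM i j k (h : 'S_n) :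
  hook_vec i j k *m aG h = hook_vec (h i) (h j) (h k).
Proof. by rewrite !mulmxDl !mulNmx !hook_blockM. Qed.

Lemma young_symmetrizer_hook (h : 'S_n) :
  young_symmetrizer n [:: m.+1; 1%N; 1%N] *m aG h = hook_vec (h p1) (h p2) (h p0).
Proof.
have bl (q : 'S_n) :
    perm_sum (fun g => g \in row_stab n [:: m.+1; 1%N; 1%N] :* q)%g *m aG h
      = hook_block (h (q p1)) (h (q p2)).
  rewrite -hook_blockM; congr (_ *m _); apply: eq_bigl => g.
  rewrite mem_rcoset row_stab_hook !permM.
  by congr (_ && _); rewrite -(inj_eq (@perm_inj _ q)) permKV.
rewrite young_symmetrizer_perm_sum mulmx_suml.
under eq_bigr do rewrite -scalemxAl bl.
rewrite (eq_bigl _ _ col_stab_hook) 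
  (big_perm_on3 (fun i j => hook_block (h i) (h j)) p01 p02 p12) //.
Qed.

Lemma specht_char_hook (g : 'S_n) :
  specht_char n [:: m.+1; 1%N; 1%N] g =
    (fixed_points g ^+ 2 - fixed_points (g * g)%g) / 2 + 1 - fixed_points g.
Proof.
(* T (i, j) is the projection of wedge i j; T3 is the cocycle identity that
   makes it fix the generators. *)
pose T (ij : 'I_n * 'I_n) := n%:R^-1 *: \sum_k hook_vec ij.1 ij.2 k.
have n0 : (n%:R : algC) != 0 by rewrite pnatr_eq0.
have two0 : (2 : algC) != 0 by rewrite pnatr_eq0.
have TC i j : T (i, j) = - T (j, i).
  rewrite /T /= -scalerN -sumrN; congr (_ *: _); apply: eq_bigr => k _.
  by apply/rowP => r; rewrite !mxE; ring.
have Tii i : T (i, i) = 0.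
  have /eqP := TC i i; rewrite -addr_eq0 -mulr2n -scaler_nat scaler_eq0 (negPf two0).
  by move/eqP.
have T3 i j k : T (i, j) + T (j, k) + T (k, i) = hook_vec i j k.
  rewrite /T /= -!scalerDr -!big_split /=.
  rewrite (eq_bigr (fun=> hook_vec i j k)) => [|l _]; last first.
    by apply/rowP => r; rewrite !mxE; ring.
  by rewrite sumr_const card_ord -[hook_vec i j k *+ n]scaler_nat scalerA mulVf ?scale1r.
(* Diagonal pairs get an arbitrary permutation, harmless because [T] vanishes on the diagonal. *)
have exk (ij : 'I_n * 'I_n) :
    exists s : 'S_n, (ij.1 != ij.2) ==> ((s p1 == ij.1) && (s p2 == ij.2)).
  have [_|ij12] := eqVneq ij.1 ij.2; first by exists 1%g.
  have [||//|s [<- <-]] := @perm_extends n [:: p1; p2] [:: ij.1; ij.2].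
  - by rewrite cons_uniq mem_seq1 p12.
  - by rewrite cons_uniq mem_seq1 ij12.
  by exists s; rewrite !eqxx.
pose k ij := xchoose (exk ij).
have kE i j x y : x != y ->
    hook_block i j 0 (gring_index G (k (x, y))) = (x == i)%:R * (y == j)%:R.
  move=> xy; have /implyP/(_ xy)/andP[/eqP kx /eqP ky] := xchooseP (exk (x, y)).
  by rewrite perm_sum_coef kx ky -natrM mulnb.
(* The factor 1/2 compensates for listing each edge in both orientations, on which [T] differs only
   by sign. *)
pose L (v : 'rV[algC]_#|G|) := \sum_ij (2^-1 * v 0 (gring_index G (k ij))) *: T ij.
have LD u v : L (u + v) = L u + L v.
  by rewrite -big_split; apply: eq_bigr => ij _; rewrite mxE mulrDr scalerDl.
have LN v : L (- v) = - L v.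
  by rewrite -sumrN; apply: eq_bigr => ij _; rewrite mxE mulrN scaleNr.
have Lblock i j : i != j -> L (hook_block i j) = 2^-1 *: T (i, j).
  move=> ij; rewrite /L (bigD1 (i, j)) //= kE // !eqxx !mulr1 big1 ?addr0 //.
  move=> [x y]; rewrite xpair_eqE => xy.
  have [->|xny] := eqVneq x y; first by rewrite Tii scaler0.
  by rewrite kE // -natrM mulnb (negPf xy) mulr0 scale0r.
have Lwedge i j : L (wedge i j) = T (i, j).
  have [->|ij] := eqVneq i j.
    rewrite Tii; apply: big1 => xy _.
    by rewrite /wedge subrr mxE mulr0 scale0r.
  have ji : j != i by rewrite eq_sym.
  rewrite /wedge LD LN !Lblock //. rewrite (TC j i) scalerN opprK -scalerDl.
  have -> : 2^-1 + 2^-1 = 1 :> algC by field.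
  by rewrite scale1r.
have Lhook i j l : L (hook_vec i j l) = hook_vec i j l.
  rewrite [in LHS]/hook_vec (LD (wedge i j + wedge j l)) (LD (wedge i j)).
  by rewrite !Lwedge T3.
rewrite (@cfRepr_specht _ _ _ T (fun=> 2^-1) k); first last.
- by move=> h; rewrite young_symmetrizer_hook -[LHS]Lhook.
- move=> [i j]; rewrite scalemx_sub // summx_sub //= => l _.
  (* Degenerate triangles have zero boundary; three distinct points are a translate of [p1], [p2],
     [p0]. *)
  have z a b : hook_vec a b a = 0 by apply/rowP => r; rewrite !mxE; ring.
  have [->|ij] := eqVneq i j.
    rewrite (_ : hook_vec _ _ _ = 0) ?sub0mx //.
    by apply/rowP => r; rewrite !mxE; ring.
  have [->|li] := eqVneq l i; first by rewrite z sub0mx.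
  have [->|lj] := eqVneq l j.
    rewrite (_ : hook_vec _ _ _ = 0) ?sub0mx //.
    by apply/rowP => r; rewrite !mxE; ring.
  have [||//|h [<- <- <-]] := @perm_extends n [:: p1; p2; p0] [:: i; j; l].
  + by rewrite !cons_uniq !in_cons !negb_or p12 ![_ == p0]eq_sym p01 p02.
  + by rewrite !cons_uniq !in_cons !negb_or ij ![_ == l]eq_sym li lj.
  rewrite -young_symmetrizer_hook.
  by rewrite (mxmodule_trans (cyclic_mx_module _ _)) ?inE ?cyclic_mx_id.
pose d (i j : 'I_n) : algC := (i == j)%:R.
have sumd j : \sum_i d i j = 1.
  by rewrite (bigD1 j) //= /d eqxx big1 ?addr0 // => i /negPf ->.
have sumdr i : \sum_j d i j = 1.
  by under eq_bigr do rewrite /d eq_sym; apply: sumd.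
have sumc (z : algC) : \sum_(i : 'I_n) z = z * n%:R.
  by rewrite sumr_const card_ord mulr_natr.
(* The products of deltas come from the edge from [g x] to [g y] itself, the terms with [n%:R^-1]
   from the edges joining its ends to the averaged third vertex. On the diagonal both sides
   vanish. *)
have entry x y : (T (x, y) *m aG g) 0 (gring_index G (k (x, y))) =
   d x (g x) * d y (g y) - d x (g y) * d y (g x)
   + n%:R^-1 * (d x (g y) - d y (g y) + d y (g x) - d x (g x)).
  have -> : T (x, y) *m aG g = T (g x, g y).
    rewrite -scalemxAl mulmx_suml [in RHS]/T /= [in RHS](reindex_inj (@perm_inj _ g)) /=.
    by congr (_ *: _); apply: eq_bigr => l _; rewrite hook_vecM.
  have [->|xy] := eqVneq x y; first by rewrite Tii mxE; ring.
  rewrite /T /= mxE summxE.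
  under eq_bigr do rewrite /hook_vec /wedge !mxE !kE // -!/(d _ _).
  rewrite !big_split /= !sumrN !sumc.
  rewrite -!mulr_sumr -!mulr_suml !sumdr.
  by move: (n%:R : algC) n0 => N n0; field.
pose f := fixed_points g.
have fE : \sum_i d i (g i) = f by apply: eq_bigr => i _; rewrite /d eq_sym.
have f2E : \sum_x \sum_y d x (g y) * d y (g x) = fixed_points (g * g)%g.
  apply: eq_bigr => x _; rewrite (bigD1 (g x)) //= big1 => [|y /negPf yx].
    by rewrite /d eqxx mulr1 addr0 permM eq_sym.
  by rewrite /d yx mulr0.
have sumg x : \sum_y d x (g y) = 1.
  by rewrite -(sumdr x) [RHS](reindex_inj (@perm_inj _ g)).
(* Over all pairs the products sum to [f ^+ 2] minus the number of fixed points of the square, the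
   averaged terms to 2 - 2 [f]. *)
transitivity (2^-1 * \sum_x \sum_y (d x (g x) * d y (g y) - d x (g y) * d y (g x)
   + n%:R^-1 * (d x (g y) - d y (g y) + d y (g x) - d x (g x)))).
  by rewrite -mulr_sumr pair_bigA; congr (_ * _); apply: eq_bigr => -[x y] _; apply: entry.
under eq_bigr => x _.
  rewrite !big_split /= sumrN -!mulr_sumr !big_split /= !sumrN fE sumd.
  rewrite sumg !sumc.
  over.
rewrite !big_split /= sumrN -!mulr_sumr f2E !big_split /= !sumrN -!mulr_suml fE !sumc.
by rewrite -/f; move: (n%:R : algC) n0 => N n0; field.
Qed.

End SpechtCharacters.

(** * Averages over conjugates *)

(** Points are grouped by orbit, an orbit of size k giving k equal terms. Point counts that see only
    orbit sizes are thus functions of the cycle type. *)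
Lemma sum_porbit_card (n : nat) (p : 'S_n) (F : nat -> algC) :
  \sum_i F #|porbit p i| = \sum_(k <- cycle_type p) k%:R * F k.
Proof.
rewrite /cycle_type (perm_big _ (permEl (perm_sort _ _))) big_map big_enum /=.
rewrite (partition_big_imset (porbit p)) /=.
apply: eq_big => [B|B /imsetP[x _ ->]].
  by apply/imsetP/imsetP => -[x _ ->]; exists x.
rewrite (eq_bigl (mem (porbit p x))) => [|i]; last first.
  by rewrite eq_porbit_mem.
rewrite (eq_bigr (fun=> F #|porbit p x|)) => [|i xi].
  by rewrite sumr_const mulr_natl.
by have /eqP -> : porbit p i == porbit p x by rewrite eq_porbit_mem.
Qed.

Lemma fixed_point_porbit (n : nat) (p : 'S_n) (i : 'I_n) :
  (p i == i) = (#|porbit p i| == 1%N).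
Proof.
have := uniq_traject_porbit p i; have := iter_porbit p i.
have := card_porbit_neq0 p i.
case: #|porbit p i| => [|[|k]] //= _; first by move=> ->; rewrite eqxx.
by move=> _; rewrite inE negb_or eq_sym => /andP[/andP[/negPf ->]].
Qed.

Lemma fixed_point_sqr_porbit (n : nat) (p : 'S_n) (i : 'I_n) :
  ((p * p)%g i == i) = (#|porbit p i| \in [:: 1%N; 2]).
Proof.
rewrite permM; have := uniq_traject_porbit p i; have := iter_porbit p i.
have := card_porbit_neq0 p i.
case: #|porbit p i| => [|[|[|k]]] //= _.
- by move=> pi _; rewrite !pi eqxx.
- by move=> pi _; rewrite pi eqxx.
by move=> _; rewrite !inE !negb_or => /andP[/and3P[_ ppi _] _]; rewrite eq_sym (negPf ppi).
Qed.

Lemma fixed_points_cycle_type (n : nat) (p q : 'S_n) :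
  cycle_type p = cycle_type q ->
  fixed_points p = fixed_points q /\ fixed_points (p * p)%g = fixed_points (q * q)%g.
Proof.
have E1 r : fixed_points r = \sum_(k <- cycle_type r) k%:R * (k == 1%N)%:R.
  rewrite -(sum_porbit_card r (fun k => (k == 1%N)%:R)).
  by apply: eq_bigr => i _; rewrite fixed_point_porbit.
have E2 r : fixed_points (r * r)%g
    = \sum_(k <- cycle_type r) k%:R * (k \in [:: 1%N; 2])%:R.
  rewrite -(sum_porbit_card r (fun k => (k \in [:: 1%N; 2])%:R)).
  by apply: eq_bigr => i _; rewrite fixed_point_sqr_porbit.
by move=> pq; rewrite !E2 !E1 pq.
Qed.

Lemma card_perm_neq0 (n : nat) : (#|{: 'S_n}|%:R : algC) != 0.
Proof. by rewrite pnatr_eq0 -lt0n; apply/card_gt0P; exists 1%g. Qed.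

(** The sum of [s (q ^ h)%g] over [q] in the class and all [h] is computed twice: conjugation by
    each [h] permutes the class, and the hypothesis evaluates the sum over [h] to a value constant
    on the class. *)
Lemma mean_statE (n : nat) (s : 'S_n -> algC) (A : algC -> algC -> algC) (p : 'S_n) :
  (forall q : 'S_n, \sum_h s (q ^ h)%g =
     #|{: 'S_n}|%:R * A (fixed_points q) (fixed_points (q * q)%g)) ->
  mean_stat s p = A (fixed_points p) (fixed_points (p * p)%g).
Proof.
move=> sA; rewrite cfunE; set C := perms_of_type n (cycle_type p).
have N0 := card_perm_neq0 n; have C0 : (#|C|%:R : algC) != 0.
  by rewrite pnatr_eq0 -lt0n; apply/card_gt0P; exists p; rewrite inE.
apply: (mulfI C0); rewrite mulVKf //; apply: (mulfI N0).
have <- : \sum_(q in C) \sum_h s (q ^ h)%g = #|{: 'S_n}|%:R * \sum_(q in C) s q.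
  rewrite exchange_big /= mulr_natl -sumr_const; apply: eq_bigr => h _.
  rewrite [RHS](reindex_inj (@conjg_inj _ h)); apply: eq_bigl => q.
  by rewrite !inE cycle_typeJ.
rewrite mulrCA mulr_natl -sumr_const; apply: eq_bigr => q.
by rewrite inE => /eqP /fixed_points_cycle_type[<- <-].
Qed.

(** * Counts of conjugates with one or two prescribed values *)

Section ConjugateCounts.

Variables (n : nat) (q : 'S_n).
Local Notation N := (#|{: 'S_n}|%:R : algC).
Local Notation f := (fixed_points q).
Local Notation f2 := (fixed_points (q * q)%g).
Local Notation d i j := ((i == j)%:R : algC).

(** The counts run over the conjugating [h], so each conjugate occurs once for every element of the
    centralizer of [q]; ratios to [N] are proportions in the conjugacy class. *)
Definition conj_count1 (i k : 'I_n) : algC := \sum_h d ((q ^ h)%g i) k.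
Definition conj_count2 (i j k l : 'I_n) : algC :=
  \sum_h d ((q ^ h)%g i) k * d ((q ^ h)%g j) l.
Local Notation c1 := conj_count1.
Local Notation c2 := conj_count2.

Lemma conj_count1J (i k : 'I_n) (s : 'S_n) : c1 (s i) (s k) = c1 i k.
Proof.
rewrite /c1 (reindex_inj (mulIg s)); apply: eq_bigr => h _.
by rewrite conjgM permJ (inj_eq perm_inj).
Qed.

Lemma conj_count2J (i j k l : 'I_n) (s : 'S_n) :
  c2 (s i) (s j) (s k) (s l) = c2 i j k l.
Proof.
rewrite /c2 (reindex_inj (mulIg s)); apply: eq_bigr => h _.
by rewrite conjgM !permJ !(inj_eq perm_inj).
Qed.

Lemma conj_count2C (i j k l : 'I_n) : c2 i j k l = c2 j i l k.
Proof. by apply: eq_bigr => h _; rewrite mulrC. Qed.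

Lemma sum_eq_ord (i : 'I_n) (F : 'I_n -> algC) : \sum_j d i j * F j = F i.
Proof.
rewrite (bigD1 i) //= eqxx mul1r big1 ?addr0 // => j /negPf ji.
by rewrite eq_sym ji mul0r.
Qed.

Lemma sum_ord_neq (i : 'I_n) (F : 'I_n -> algC) (z : algC) :
  (forall j, j != i -> F j = z) -> \sum_j F j = F i + (n%:R - 1) * z.
Proof.
move=> Fz; rewrite (bigD1 i) //=; congr (_ + _).
rewrite (eq_bigr (fun=> z)) // sumr_const cardC1 card_ord -[LHS]mulr_natl.
by rewrite -subn1 natrB // (leq_trans _ (ltn_ord i)).
Qed.

Lemma sum_ord_neq2 (i j : 'I_n) (F : 'I_n -> algC) (z : algC) :
  i != j -> (forall l, l != i -> l != j -> F l = z) ->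
  \sum_l F l = F i + F j + (n%:R - 2) * z.
Proof.
(* The value at [j] is replaced by [z], so that only [i] remains exceptional. *)
move=> ij Fz; have -> : \sum_l F l = \sum_l (F l + d j l * (z - F l)) - (z - F j).
  by rewrite big_split /= sum_eq_ord addrK.
rewrite (sum_ord_neq (i := i) (z := z)) => [|l li].
  by rewrite eq_sym (negPf ij) mul0r; ring.
have [<-|lj] := eqVneq j l; first by rewrite mul1r; ring.
by rewrite mul0r addr0 Fz // eq_sym.
Qed.

Lemma fixed_pointsJ (g h : 'S_n) : fixed_points (g ^ h)%g = fixed_points g.
Proof.
rewrite /fixed_points (reindex_inj (@perm_inj _ h)); apply: eq_bigr => i _.
by rewrite permJ (inj_eq perm_inj).
Qed.

(** All diagonal counts agree, and together they count the fixed points of every conjugate, [f] each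
    time. *)
Lemma conj_count1_eq (i : 'I_n) : n%:R * c1 i i = N * f.
Proof.
transitivity (\sum_j c1 j j).
  rewrite (eq_bigr (fun=> c1 i i)) => [|j _]; first by rewrite sumr_const card_ord mulr_natl.
  by rewrite -(conj_count1J i i (tperm i j)) tpermL.
rewrite exchange_big /= (eq_bigr (fun=> f)) => [|h _]; last exact: fixed_pointsJ.
by rewrite sumr_const mulr_natl.
Qed.

Lemma conj_count1_neq (i j : 'I_n) : i != j -> c1 i i + (n%:R - 1) * c1 i j = N.
Proof.
move=> ij; transitivity (\sum_k c1 i k).
  rewrite (sum_ord_neq (i := i) (z := c1 i j)) // => k ki.
  by rewrite -(conj_count1J i j (tperm j k)) tpermL tpermD // eq_sym.
rewrite exchange_big /= (eq_bigr (fun=> 1)) => [|h _]; first by rewrite sumr_const.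
under eq_bigr do rewrite -[d _ _]mulr1.
exact: sum_eq_ord.
Qed.

(** By double transitivity [F] is constant on the n(n-1) pairs of distinct points. *)
Lemma sum_distinct_pairs (F : 'I_n -> 'I_n -> algC) (i j : 'I_n) : i != j ->
  (forall (s : 'S_n) x y, F (s x) (s y) = F x y) ->
  n%:R * (n%:R - 1) * F i j = \sum_x \sum_y F x y - \sum_x F x x.
Proof.
move=> ij FJ; rewrite -sumrB (eq_bigr (fun=> (n%:R - 1) * F i j)) => [|x _].
  by rewrite sumr_const card_ord -[RHS]mulr_natl mulrA.
rewrite (sum_ord_neq (i := x) (z := F i j)) ?(addrC (F x x)) ?addrK // => y yx.
have [||//|s [<- <-]] := @perm_extends n [:: i; j] [:: x; y]; last exact: FJ.
  by rewrite cons_uniq mem_seq1 ij.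
by rewrite cons_uniq mem_seq1 eq_sym yx.
Qed.

Lemma conj_count2_fix (i j : 'I_n) : i != j ->
  n%:R * (n%:R - 1) * c2 i j i j = N * (f ^+ 2 - f).
Proof.
move=> ij; rewrite (sum_distinct_pairs (F := fun x y => c2 x y x y)) //; last first.
  by move=> s x y; rewrite conj_count2J.
under eq_bigr do rewrite exchange_big.
rewrite exchange_big [X in _ - X]exchange_big -sumrB /= (eq_bigr (fun=> f ^+ 2 - f)).
  by rewrite sumr_const mulr_natl.
move=> h _; rewrite expr2 -{1 2 3}(fixed_pointsJ q h); congr (_ - _).
  by rewrite /fixed_points mulr_suml; apply: eq_bigr => x _; rewrite mulr_sumr.
by apply: eq_bigr => x _; rewrite -natrM mulnb andbb.
Qed.

(** Over all pairs, x going to y and y to x means that x is fixed by the square; removing the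
    diagonal subtracts the fixed points. *)
Lemma conj_count2_swap (i j : 'I_n) : i != j ->
  n%:R * (n%:R - 1) * c2 i j j i = N * (f2 - f).
Proof.
move=> ij; rewrite (sum_distinct_pairs (F := fun x y => c2 x y y x)) //; last first.
  by move=> s x y; rewrite conj_count2J.
under eq_bigr do rewrite exchange_big.
rewrite exchange_big [X in _ - X]exchange_big -sumrB /= (eq_bigr (fun=> f2 - f)).
  by rewrite sumr_const mulr_natl.
move=> h _; rewrite -(fixed_pointsJ q h) -(fixed_pointsJ (q * q)%g h) conjMg; congr (_ - _).
  by apply: eq_bigr => x _; rewrite sum_eq_ord (permM (q ^ h)%g (q ^ h)%g).
by apply: eq_bigr => x _; rewrite -natrM mulnb andbb.
Qed.

(** With [i] fixed, the image of [j] runs over all [k]: injectivity excludes [i], and the points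
    other than [i] and [j] share one count. The next lemma does the same with [i] sent to [j]. *)
Lemma conj_count2_fix1 (i j l : 'I_n) : i != j -> l != i -> l != j ->
  (n%:R - 2) * c2 i j i l = c1 i i - c2 i j i j.
Proof.
move=> ij li lj; have -> : c1 i i = \sum_k c2 i j i k.
  rewrite exchange_big; apply: eq_bigr => h _ /=.
  rewrite -mulr_sumr; under eq_bigr do rewrite -[d _ _]mulr1.
  by rewrite sum_eq_ord mulr1.
rewrite (sum_ord_neq2 (z := c2 i j i l) ij) => [|k ki kj].
  have -> : c2 i j i i = 0; last ring.
  apply: big1 => h _; rewrite -natrM mulnb; case: eqP => //= <-.
  by rewrite (inj_eq perm_inj) eq_sym (negPf ij).
by rewrite -(conj_count2J i j i l (tperm l k)) tpermL !tpermD.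
Qed.

Lemma conj_count2_move1 (i j l : 'I_n) : i != j -> l != i -> l != j ->
  (n%:R - 2) * c2 i j j l = c1 i j - c2 i j j i.
Proof.
move=> ij li lj; have -> : c1 i j = \sum_k c2 i j j k.
  rewrite exchange_big; apply: eq_bigr => h _ /=.
  rewrite -mulr_sumr; under eq_bigr do rewrite -[d _ _]mulr1.
  by rewrite sum_eq_ord mulr1.
rewrite (sum_ord_neq2 (z := c2 i j j l) ij) => [|k ki kj].
  have -> : c2 i j j j = 0; last ring.
  apply: big1 => h _; rewrite -natrM mulnb; case: eqP => //= gi.
  by rewrite -{2}gi (inj_eq perm_inj) eq_sym (negPf ij).
by rewrite -(conj_count2J i j j l (tperm l k)) tpermL !tpermD.
Qed.


(** * Order signs summed over conjugates *)

(** At the images of positions [i < j] this is 1 on an inversion and -1 otherwise. Antisymmetry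
    makes constants sum to zero against it. *)
Definition order_sign (k l : 'I_n) : algC := (l < k)%:R - (k < l)%:R.
Local Notation sg := order_sign.

Lemma order_signC (k l : 'I_n) : sg k l = - sg l k.
Proof. by rewrite /order_sign opprB. Qed.

Lemma order_sign_diag (k : 'I_n) : sg k k = 0.
Proof. exact: subrr. Qed.

Lemma sum_ord_ltn (k : nat) : (k <= n)%N -> \sum_(l < n) (l < k)%:R = k%:R :> algC.
Proof.
move=> kn; rewrite -natr_sum; congr (_%:R).
suff: forall m, (\sum_(l < m) (l < k) = minn k m)%N by move=> ->; apply/minn_idPl.
elim=> [|m IH]; first by rewrite big_ord0 minn0.
by rewrite big_ord_recr /= IH; lia.
Qed.

Lemma sum_order_sign (i : 'I_n) : \sum_l sg i l = (i%:R *+ 2) + 1 - n%:R.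
Proof.
rewrite sumrB sum_ord_ltn 1?ltnW //.
have -> : \sum_(l < n) (i < l)%:R = \sum_(l < n) (1 - (l < i.+1)%:R) :> algC.
  by apply: eq_bigr => l _; rewrite ltnS (leqNgt l i); case: (i < l)%N; rewrite ?subrr ?subr0.
rewrite sumrB sumr_const card_ord sum_ord_ltn // -[i.+1]addn1 natrD; ring.
Qed.

(** The count of images (k, l) is a combination of deltas. Against the sign, each single delta
    leaves a row sum of signs, affine in its index; this is how the distance from [i] to [j]
    enters. *)
Lemma sum_conj_sign (i j : 'I_n) : (2 < n)%N -> (i < j)%N ->
  \sum_h sg ((q ^ h)%g i) ((q ^ h)%g j) =
    c2 i j j i - c2 i j i j - (j%:R - i%:R - 1) * 2 *
      ((c1 i i - c2 i j i j - c1 i j + c2 i j j i) / (n%:R - 2)).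
Proof.
move=> n3 ltij; have ij : i != j by rewrite -val_eqE /= ltn_eqF.
have ji : j != i by rewrite eq_sym.
have n20 : (n%:R - 2 : algC) != 0 by rewrite subr_eq0 eqr_nat gtn_eqF.
(* [w0] and [w1] belong to the images (i, j) and (j, i). In [w2] one of the two positions is fixed,
   in [w4] one is sent to the other; the remaining image lies outside. *)
pose w0 := c2 i j i j; pose w1 := c2 i j j i.
pose w2 := (c1 i i - w0) / (n%:R - 2); pose w4 := (c1 i j - w1) / (n%:R - 2).
have W2 l : l != i -> l != j -> c2 i j i l = w2.
  by move=> li lj; apply: (mulfI n20); rewrite conj_count2_fix1 // mulrC divfK.
have W4 l : l != i -> l != j -> c2 i j j l = w4.
  by move=> li lj; apply: (mulfI n20); rewrite conj_count2_move1 // mulrC divfK.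
have W2' k : k != i -> k != j -> c2 i j k j = w2.
  move=> ki kj; rewrite -(W2 _ ki kj) conj_count2C.
  by rewrite -(conj_count2J j i j k (tperm i j)) tpermL tpermR tpermD // eq_sym.
have W4' k : k != i -> k != j -> c2 i j k i = w4.
  move=> ki kj; rewrite -(W4 _ ki kj) conj_count2C.
  by rewrite -(conj_count2J j i i k (tperm i j)) tpermL tpermR tpermD // eq_sym.
(* For n = 3 there is no such pair (k, l); z cancels in the final sum. *)
have [z Wz] : exists z, forall k l, uniq [:: i; j; k; l] -> c2 i j k l = z.
  case: (pickP (fun kl : 'I_n * 'I_n => uniq [:: i; j; kl.1; kl.2])) => [[k l] /= U|no].
    exists (c2 i j k l) => k' l' U'.
    have [//|//|//|s [si sj <- <-]] := @perm_extends n [:: i; j; k; l] [:: i; j; k'; l'].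
    by rewrite -{1}si -{1}sj conj_count2J.
  by exists 0 => k l U; have := no (k, l); rewrite U.
(* Inclusion and exclusion over the equality patterns. The factor [sg k l] removes the case [k = l],
   where the bracket may differ from the count. *)
have c2E k l : c2 i j k l * sg k l =
    (z + (w0 - w2 *+ 2 + z) * (d i k * d j l) + (w1 - w4 *+ 2 + z) * (d j k * d i l)
     + (w2 - z) * d i k + (w2 - z) * d j l + (w4 - z) * d j k + (w4 - z) * d i l)
     * sg k l.
  have [->|kl] := eqVneq k l; first by rewrite order_sign_diag !mulr0.
  congr (_ * _); rewrite ![_ == k]eq_sym ![_ == l]eq_sym.
  have [ki|ki] := eqVneq k i; have [kj|kj] := eqVneq k j.
  - by rewrite -ki -kj eqxx in ij.
  - rewrite ki in kl *; rewrite [l == i]eq_sym (negPf kl).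
    have [->|lj] := eqVneq l j; first by rewrite -/w0 /=; ring.
    by rewrite W2 // 1?eq_sym //=; ring.
  - rewrite kj in kl *; rewrite [l == j]eq_sym (negPf kl).
    have [->|li] := eqVneq l i; first by rewrite -/w1 /=; ring.
    by rewrite W4 // 1?eq_sym //=; ring.
  have [li|li] := eqVneq l i; have [lj|lj] := eqVneq l j.
  - by rewrite -li -lj eqxx in ij.
  - by rewrite li W4' //=; ring.
  - by rewrite lj W2' //=; ring.
  rewrite Wz /=; first ring.
  by rewrite !inE !negb_or ij kl ![i == _]eq_sym ![j == _]eq_sym ki li kj lj.
transitivity (\sum_k \sum_l c2 i j k l * sg k l).
  rewrite (eq_bigr (fun h => \sum_k \sum_l
      d ((q ^ h)%g i) k * (d ((q ^ h)%g j) l * sg k l))).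
    rewrite exchange_big; apply: eq_bigr => k _.
    rewrite exchange_big; apply: eq_bigr => l _.
    by rewrite mulr_suml; apply: eq_bigr => h _; rewrite mulrA.
  move=> h _; under eq_bigr do rewrite -mulr_sumr sum_eq_ord.
  by rewrite sum_eq_ord.
have S0 : \sum_k \sum_l sg k l = 0.
  have : \sum_k \sum_l sg k l = - \sum_k \sum_l sg k l.
    rewrite [in LHS]exchange_big -sumrN; apply: eq_bigr => k _.
    by rewrite -sumrN; apply: eq_bigr => l _; apply: order_signC.
  by move/eqP; rewrite -addr_eq0 -mulr2n mulrn_eq0 => /eqP.
have Sc x : \sum_k \sum_l d x l * sg k l = - \sum_l sg x l.
  under eq_bigr do rewrite sum_eq_ord.
  by rewrite -sumrN; apply: eq_bigr => k _; apply: order_signC.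
under eq_bigr => k _.
  under eq_bigr => l _ do rewrite c2E !mulrDl -!mulrA.
  rewrite !big_split /= -!mulr_sumr.
  over.
rewrite !big_split /= -!mulr_sumr S0 !Sc !sum_eq_ord !sum_order_sign.
have sij : sg i j = -1 by rewrite /order_sign ltij ltnNge ltnW ?sub0r.
rewrite [sg j i]order_signC sij -/w0 -/w1. rewrite /w2 /w4; field; exact: n20.
Qed.


(** The distance enters through [j - i - 1], which vanishes for adjacent positions, so descents and
    the major index see the constant term alone. *)
Lemma sum_conj_inversion (i j : 'I_n) : (2 < n)%N -> (i < j)%N ->
  \sum_h ((q ^ h)%g j < (q ^ h)%g i)%:R =
    N * (1 / 2 + (f2 - f ^+ 2) / (2 * n%:R * (n%:R - 1)) - (j%:R - i%:R - 1) *
      (((n%:R - 1) * f - (n%:R - f) + (f2 - f ^+ 2))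
         / (n%:R * (n%:R - 1) * (n%:R - 2)))).
Proof.
move=> n3 ltij; have ij : i != j by rewrite -val_eqE /= ltn_eqF.
have n0 : (n%:R : algC) != 0 by rewrite pnatr_eq0; lia.
have n10 : (n%:R - 1 : algC) != 0 by rewrite subr_eq0 pnatr_eq1; lia.
have n20 : (n%:R - 2 : algC) != 0 by rewrite subr_eq0 eqr_nat; lia.
(* On distinct values the sign is twice the inversion indicator minus 1. *)
set S := LHS; have SE : 2 * S - N = \sum_h sg ((q ^ h)%g i) ((q ^ h)%g j).
  rewrite -sumr_const mulr_sumr -sumrB; apply: eq_bigr => h _.
  rewrite /order_sign; case: ltngtP => [_|_|/val_inj/perm_inj e]; rewrite /=; try ring.
  by rewrite e eqxx in ij.
have -> : S = (N + (2 * S - N)) / 2 by field.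
rewrite SE sum_conj_sign //.
have W0 := conj_count2_fix ij; have W1 := conj_count2_swap ij.
have V0 := conj_count1_eq i; have V1 := conj_count1_neq ij.
have -> : c2 i j i j = N * (f ^+ 2 - f) / (n%:R * (n%:R - 1)).
  by rewrite -W0; field; rewrite n0 n10.
have -> : c2 i j j i = N * (f2 - f) / (n%:R * (n%:R - 1)).
  by rewrite -W1; field; rewrite n0 n10.
have {}V0 : c1 i i = N * f / n%:R by rewrite -V0; field.
have -> : c1 i j = (N - N * f / n%:R) / (n%:R - 1).
  by rewrite -V0 -{1}V1; field.
by rewrite V0; field; rewrite n0 n10 n20.
Qed.

End ConjugateCounts.

(** * Means of weighted inversion counts *)

(** All three statistics have this form: [a] is 1 or [i.+1] on adjacent positions, or 1 on all pairs
    [i < j]. Linearity allows averaging pair by pair. *)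
Lemma mean_stat_pairs (n : nat) (s : 'S_n -> algC) (a : 'I_n -> 'I_n -> algC) (p : 'S_n) :
  (2 < n)%N -> (forall i j : 'I_n, ~~ (i < j)%N -> a i j = 0) ->
  (forall q, s q = \sum_i \sum_j a i j * (q j < q i)%:R) ->
  let f := fixed_points p in let f2 := fixed_points (p * p)%g in
  mean_stat s p = \sum_i \sum_j a i j *
    (1 / 2 + (f2 - f ^+ 2) / (2 * n%:R * (n%:R - 1)) - (j%:R - i%:R - 1) *
      (((n%:R - 1) * f - (n%:R - f) + (f2 - f ^+ 2))
         / (n%:R * (n%:R - 1) * (n%:R - 2)))).
Proof.
move=> n3 a0 sE f f2; rewrite {}/f {}/f2.
pose A (f f2 : algC) := \sum_(i < n) \sum_(j < n) a i j *
    (1 / 2 + (f2 - f ^+ 2) / (2 * n%:R * (n%:R - 1)) - (j%:R - i%:R - 1) *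
      (((n%:R - 1) * f - (n%:R - f) + (f2 - f ^+ 2))
         / (n%:R * (n%:R - 1) * (n%:R - 2)))).
apply: (mean_statE (A := A)) => q.
under eq_bigr do rewrite sE; rewrite exchange_big mulr_sumr; apply: eq_bigr => i _.
rewrite exchange_big mulr_sumr; apply: eq_bigr => j _; rewrite -mulr_sumr.
have [ij|ij] := boolP (i < j)%N; last by rewrite a0 // !mul0r mulr0.
by rewrite sum_conj_inversion // mulrCA.
Qed.

Lemma sum_ord_succ (m : nat) (F : nat -> algC) :
  \sum_(i < m) \sum_(j < m) (j == i.+1 :> nat)%:R * F i = \sum_(i < m.-1) F i.
Proof.
case: m => [|m]; first by rewrite !big_ord0.
rewrite big_ord_recr /= [X in _ + X]big1 ?addr0 => [|j _]; last first.
  by rewrite ltn_eqF ?mul0r.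
apply: eq_bigr => i _; rewrite -mulr_suml.
rewrite (bigD1 (lift ord0 i)) //= /bump add1n eqxx big1 ?addr0 ?mul1r // => j.
by rewrite -val_eqE /= /bump add1n => /negPf ->.
Qed.

Lemma sum_ord_affine (m : nat) (A c u : algC) :
  \sum_(i < m) (A - (c - i%:R - 1) * u)
    = m%:R * A - (m%:R * (c - 1) - m%:R * (m%:R - 1) / 2) * u.
Proof.
elim: m => [|m IH]; first by rewrite big_ord0; field.
by rewrite big_ord_recr /= IH -natr1; field.
Qed.

(** The coefficients are the binomials of [m] over 2 and over 3, since [j - i - 1] counts the points
    strictly between [i] and [j]. *)
Lemma sum_lt_affine (m : nat) (A u : algC) :
  \sum_(i < m) \sum_(j < m) (i < j)%:R * (A - (j%:R - i%:R - 1) * u)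
    = m%:R * (m%:R - 1) / 2 * A - m%:R * (m%:R - 1) * (m%:R - 2) / 6 * u.
Proof.
elim: m => [|m IH]; first by rewrite big_ord0; field.
rewrite big_ord_recr /= [X in _ + X]big1 ?addr0 => [|j _]; last first.
  by rewrite ltnNge -ltnS ltn_ord mul0r.
under eq_bigr do rewrite big_ord_recr /=.
rewrite big_split /= IH; under [X in _ + X]eq_bigr do rewrite ltn_ord mul1r.
by rewrite sum_ord_affine -natr1; field.
Qed.

Lemma sum_ord_natr (m : nat) : \sum_(i < m) i.+1%:R = m%:R * (m%:R + 1) / 2 :> algC.
Proof.
elim: m => [|m IH]; first by rewrite big_ord0; field.
by rewrite big_ord_recr /= IH -natr1; field.
Qed.

(** * The three mean statistics in terms of fixed points *)

Section MeanStatistics.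

Variables (n : nat) (p : 'S_n).
Hypothesis n3 : (2 < n)%N.
Local Notation f := (fixed_points p).
Local Notation f2 := (fixed_points (p * p)%g).

Let n0 : (n%:R : algC) != 0. Proof. by rewrite pnatr_eq0; lia. Qed.
Let n10 : (n%:R - 1 : algC) != 0. Proof. by rewrite subr_eq0 pnatr_eq1; lia. Qed.
Let n20 : (n%:R - 2 : algC) != 0. Proof. by rewrite subr_eq0 eqr_nat; lia. Qed.

Let natr_pred : n.-1%:R = n%:R - 1 :> algC.
Proof. by rewrite -subn1 natrB // ltnW // ltnW. Qed.

Let adjacent_weight (i j : 'I_n) (A u : algC) :
  (j == i.+1 :> nat)%:R * (A - (j%:R - i%:R - 1) * u) = (j == i.+1 :> nat)%:R * A.
Proof.
case: eqP => [->|_]; last by rewrite !mul0r.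
by rewrite -natr1; ring.
Qed.

Lemma descentE (q : 'S_n) (i : 'I_n) :
  (i \in descents q)%:R
    = \sum_(j < n) (j == i.+1 :> nat)%:R * (q j < q i)%:R :> algC.
Proof.
rewrite inE; case: existsP => [[j /andP[ji qji]]|no].
  rewrite (bigD1 j) //= ji qji mulr1 big1 ?addr0 // => k kj.
  by rewrite -(eqP ji) val_eqE (negPf kj) mul0r.
rewrite big1 // => j _; rewrite -natrM mulnb.
by case: andP => // jP; case: no; exists j; apply/andP.
Qed.

Lemma mean_descents :
  mean_stat (fun q : 'S_n => (num_descents q)%:R) p
    = (n%:R - 1) / 2 + (f2 - f ^+ 2) / (2 * n%:R).
Proof.
rewrite (mean_stat_pairs (a := fun i j => (j == i.+1 :> nat)%:R)) //; first last.
- move=> q; rewrite /num_descents -sum1_card natr_sum big_mkcond /=.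
  by apply: eq_bigr => i _; rewrite -descentE; case: (_ \in _).
- by move=> i j ij; case: eqP => // ji; rewrite ji ltnSn in ij.
under eq_bigr do under eq_bigr do rewrite adjacent_weight.
pose E := 1 / 2 + (f2 - f ^+ 2) / (2 * n%:R * (n%:R - 1)).
rewrite (sum_ord_succ n (fun=> E)) sumr_const card_ord -[LHS]mulr_natl natr_pred.
by rewrite /E; field; rewrite n0 n10.
Qed.

(** All adjacent pairs have the same mean, and the weights 1, ..., n-1 sum to n/2 times the number
    of these pairs; hence the factor n/2 over the descent number. *)
Lemma mean_major_index :
  mean_stat (fun q : 'S_n => (major_index q)%:R) p
    = n%:R / 2 * ((n%:R - 1) / 2 + (f2 - f ^+ 2) / (2 * n%:R)).
Proof.
rewrite (mean_stat_pairs (a := fun i j => (j == i.+1 :> nat)%:R * i.+1%:R)) //; first last.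
- move=> q; rewrite /major_index natr_sum big_mkcond /=.
  apply: eq_bigr => i _; under eq_bigr do rewrite mulrAC.
  by rewrite -mulr_suml -descentE; case: (_ \in _); rewrite ?mul1r ?mul0r.
- by move=> i j ij; case: eqP => [ji|_]; [rewrite ji ltnSn in ij | rewrite mul0r].
under eq_bigr do under eq_bigr do rewrite mulrAC adjacent_weight -[_ * _.+1%:R]mulrA.
pose E := 1 / 2 + (f2 - f ^+ 2) / (2 * n%:R * (n%:R - 1)).
rewrite (sum_ord_succ n (fun i => E * i.+1%:R)) -mulr_sumr sum_ord_natr natr_pred.
by rewrite /E; field; rewrite n0 n10.
Qed.

Lemma mean_inversions :
  mean_stat (fun q : 'S_n => (num_inversions q)%:R) p
    = n%:R * (n%:R - 1) / 4 + (f2 - f ^+ 2) / 4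
      - ((n%:R - 1) * f - (n%:R - f) + (f2 - f ^+ 2)) / 6.
Proof.
rewrite (mean_stat_pairs (a := fun i j => (i < j)%:R)) //; first last.
- move=> q; rewrite /num_inversions -sum1_card natr_sum big_mkcond /= pair_bigA /=.
  apply: eq_bigr => -[i j] _; rewrite inE /= -natrM mulnb.
  by case: (_ && _).
- by move=> i j /negPf ->.
by rewrite sum_lt_affine; field; rewrite n0 n10 n20.
Qed.

End MeanStatistics.

(** * Comparison of the means with the characters *)

Theorem theorem6p2 (n : nat) (hn : (3 <= n)%N) :
  let chi := specht_char n in
  let mean_des := mean_stat (fun p : 'S_n => (num_descents p)%:R) in
  let mean_maj := mean_stat (fun p : 'S_n => (major_index p)%:R) in
  let mean_inv := mean_stat (fun p : 'S_n => (num_inversions p)%:R) in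
  [/\ mean_des = ((n%:R - 1) / 2) *: chi [:: n]
                 - (1 / n%:R) *: chi [:: (n - 1)%N; 1%N]
                 - (1 / n%:R) *: chi [:: (n - 2)%N; 1%N; 1%N],
      mean_maj = (n%:R / 2) *: mean_des,
      mean_maj = (n%:R * (n%:R - 1) / 4) *: chi [:: n]
                 - (1 / 2) *: chi [:: (n - 1)%N; 1%N]
                 - (1 / 2) *: chi [:: (n - 2)%N; 1%N; 1%N]
    & mean_inv = (n%:R * (n%:R - 1) / 4) *: chi [:: n]
                 - ((n%:R + 1) / 6) *: chi [:: (n - 1)%N; 1%N]
                 - (1 / 6) *: chi [:: (n - 2)%N; 1%N; 1%N]].
Proof.
move=> chi.
have chiE p : [/\ chi [:: n] p = 1,
    chi [:: (n - 1)%N; 1%N] p = fixed_points p - 1 &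
    chi [:: (n - 2)%N; 1%N; 1%N] p =
      (fixed_points p ^+ 2 - fixed_points (p * p)%g) / 2 + 1 - fixed_points p].
  rewrite {}/chi; case: n hn p => [|[|[|m]]] // _ p.
  rewrite !subSS !subn0; split.
  - exact: specht_char_row.
  - exact: specht_char_std.
  - exact: specht_char_hook.
move=> mean_des mean_maj mean_inv.
have n0 : (n%:R : algC) != 0 by rewrite pnatr_eq0; lia.
have desE p : mean_des p = _ := mean_descents p hn.
have majE p : mean_maj p = _ := mean_major_index p hn.
have invE p : mean_inv p = _ := mean_inversions p hn.
clearbody chi mean_des mean_maj mean_inv.
(* Pointwise, both sides are rational expressions in [n] and the numbers of fixed points of [p] and
   of its square. *)
split; apply/cfunP => p; have [c1 c2 c3] := chiE p.
- by rewrite !cfunE c1 c2 c3 desE; field.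
- by rewrite !cfunE majE desE.
- by rewrite !cfunE c1 c2 c3 majE; field.
- by rewrite !cfunE c1 c2 c3 invE; field.
Qed.
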